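(* There exists an absolute constant $c>0$ such that every connected vertex-transitive digraph $D$ on $n\ge 2$ vertices contains a directed cycle of length at least $c\sqrt{n}$.
   Context: All digraphs are finite; as usual they have no loops or parallel arcs, but a pair of opposite arcs is allowed (and then forms a directed cycle of length $2$). A digraph $D$ is vertex-transitive if for every pair of vertices $u,v\in V(D)$ there is an automorphism of $D$ mapping $u$ to $v$. A digraph is connected if its underlying undirected graph is connected (for finite vertex-transitive digraphs this is equivalent to strong connectivity). Directed cycles do not repeat vertices, and the length of a directed cycle is its number of arcs. *)

(* Defs.v *)
From mathcomp Require Import all_boot all_order all_fingroup all_algebra.
From mathcomp Require Import reals.
Set Implicit Arguments.
Unset Strict Implicit.
Unset Printing Implicit Defensive.

(* A finite digraph on vertex set T is an irreflexive relation arc : rel T,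
   where arc x y means that there is an arc from x to y. Since arc need not be
   antisymmetric, pairs of opposite arcs are allowed. *)

Definition digraph_aut (T : finType) (arc : rel T) (f : {perm T}) : Prop :=
  forall x y : T, arc (f x) (f y) = arc x y.

Definition vertex_transitive (T : finType) (arc : rel T) : Prop :=
  forall u v : T, exists2 f : {perm T}, digraph_aut arc f & f u = v.

Definition underlying (T : finType) (arc : rel T) : rel T :=
  [rel x y | arc x y || arc y x].

Definition digraph_connected (T : finType) (arc : rel T) : Prop :=
  forall x y : T, connect (underlying arc) x y.

(* A directed cycle is given by the sequence of its distinct vertices in cyclic
   order, so that its number of arcs is size s. The sequence is required to be
   nonempty because ucycle also holds of [::]. *)
Definition directed_cycle (T : finType) (arc : rel T) (s : seq T) : Prop :=
  s <> [::] /\ ucycle arc s.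

(* Main.v *)
Require Import Defs.
From mathcomp Require Import all_boot all_order all_fingroup all_algebra.
From mathcomp Require Import reals.
From mathcomp Require Import zify.
Import Order.TTheory GRing.Theory Num.Theory.
Set Implicit Arguments.
Unset Strict Implicit.
Unset Printing Implicit Defensive.

(** Let [L] be the length of a longest directed cycle and [n] the number of
vertices; the proof shows [n <= 144 L^2].

Suppose first that deleting any directed path on at most [L + 1] vertices
leaves a strong component with more than half of all vertices. Then a directed
path [P] can be grown for ever, which is absurd ([haven_absurd]). The growth
keeps a route outside [P] from the end of [P] to the large component [C] that
survives the deletion of the last [L] vertices of [P]. If [C] could reach a
vertex of [P] older than those [L], that route would close a directed cycle
with more than [L] vertices; so older vertices of [P] can be put back into the
digraph without joining [C], and only [L + 1] vertices ever need to be deleted.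

It remains to find these large components when [144 L^2 < n]. A set [S] of at
most [L + 1] vertices near [v] leaves a large strong component as soon as every
set [X] whose out-arcs lead only to [X] and [S] is either small or co-small
([big_scc_of_small]). Small means one of two things, depending on the diameter
[d] of the underlying graph.

- If [d] is [O(L)], small means of cardinality [O(d L)], and the dichotomy is
  the isoperimetric inequality [|X| (n - |X|) <= n d |S|] ([isoperimetry]). Its
  proof averages over the automorphisms [g]: for an arc [u -> v], whenever
  [g u] is in [X] and [g v] is not, [g v] is in [S], so this happens for a
  proportion at most [|S| / n] of the [g]; and since [g u] and [g v] are
  equidistributed, [g] takes [v] into [X] and [u] out of it equally often.

- If [d] is larger, small means contained in the ball of radius [4 L] about
  [v], which contains less than half of the vertices. An arc between [X] and
  its complement that avoids [S] enters [X]; it lies on a directed cycle, which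
  has to leave [X] through [S], so the arc is within [2 L] of [v]. Hence all
  the contact between [X] and its complement takes place in the ball of radius
  [2 L], and a vertex-transitive graph has only one end beyond such a ball
  ([one_end]): all vertices outside the ball of radius [4 L] lie on the same
  side ([outclosed_in_ball]). *)

(** * Reachability and strong components after a deletion *)

Section Reach.
Variables (T : finType) (arc : rel T).
Implicit Types (A B X : {set T}) (x y z : T) (p q s : seq T).

(** The start of a path is allowed to lie in [A]; this lets [A] contain the
vertex from which a search starts. *)
Definition off A x y := arc x y && (y \notin A).
Arguments off A x y /.

Definition scc A x := [set y | connect (off A) x y && connect (off A) y x].

Lemma off_path A x p :
  path arc x p -> {in p, forall z, z \notin A} -> connect (off A) x (last x p).
Proof.
move=> xp pA; apply/connectP; exists p => //.
elim: p x xp pA => //= y p IH x /andP[xy yp] pA.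
rewrite xy pA ?mem_head //=; apply: IH => // z zp.
by apply: pA; rewrite inE zp orbT.
Qed.

Lemma connect_offP A x y : connect (off A) x y ->
  exists p, [/\ path arc x p, last x p = y, uniq (x :: p)
              & {in p, forall z, z \notin A}].
Proof.
case/connectP => p xp ->; case/shortenP: xp => q xq uq _.
exists q; split=> //; elim: q x xq {uq} => //= [z q IH] x.
- by case/andP => /andP[-> _]; exact: IH.
move=> /andP[/andP[_ zA] zq] w; rewrite inE => /predU1P[->//|wq].
exact: IH zq _ wq.
Qed.

Lemma connect_off0 x y : connect arc x y -> connect (off set0) x y.
Proof. by apply: connect_sub => u v uv; apply: connect1; rewrite /= uv inE. Qed.

Lemma connect_off_sub A B x y :
  B \subset A -> connect (off A) x y -> connect (off B) x y.
Proof.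
move=> BA; apply: connect_sub => u v /andP[uv vA].
by apply: connect1; rewrite /= uv; apply: contra vA; apply: (subsetP BA).
Qed.

(** A simple path does not come back to its first vertex. *)
Lemma connect_off_self A x y :
  connect (off A) x y -> connect (off (x |: A)) x y.
Proof.
case/connect_offP => p [xp <- /= /andP[xNp _] pA]; apply: off_path => // z zp.
by rewrite !inE negb_or pA // andbT; apply: contraNneq xNp => <-.
Qed.

Lemma connect_off_notin A x y : connect (off A) x y -> x \notin A -> y \notin A.
Proof.
case/connect_offP => p [_ <- _ pA] xA.
by have := mem_last x p; rewrite inE => /predU1P[->|/pA].
Qed.

(** Stop a path at its first entry into [B]. *)
Lemma connect_off_hit A B x z :
    connect (off A) x z -> x \notin B -> z \in B ->
  exists u w, [/\ connect (off (A :|: B)) x u, arc u w, w \in B & w \notin A].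
Proof.
case/connectP => p; elim: p x => [|y p IH] x /=.
  by move=> _ -> /negbTE ->.
move=> /andP[/andP[xy yA] yp] lz xB zB; case: (boolP (y \in B)) => yB.
  by exists x, y; rewrite connect0.
have [u [w [yu uw wB wA]]] := IH y yp lz yB zB; exists u, w; split=> //.
by apply: connect_trans yu; apply: connect1; rewrite /= xy inE negb_or yA.
Qed.

Lemma sccxx A x : x \in scc A x.
Proof. by rewrite inE !connect0. Qed.

Lemma scc_sub A B x y :
  B \subset A -> y \in scc A x -> scc A x \subset scc B y.
Proof.
move=> BA; rewrite inE => /andP[xy yx]; apply/subsetP=> z.
rewrite !inE => /andP[xz zx].
by rewrite !(connect_off_sub BA) ?(connect_trans yx xz) ?(connect_trans zx xy).
Qed.

Lemma scc_notin A x y : x \notin A -> y \in scc A x -> y \notin A.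
Proof. by move=> xA; rewrite inE => /andP[/connect_off_notin-> ]. Qed.

Lemma scc_eq A x y : y \in scc A x -> scc A x = scc A y.
Proof.
move=> yx; apply/eqP; rewrite eqEsubset !scc_sub //.
by move: yx; rewrite !inE andbC.
Qed.

(** A path between two vertices of a strong component never leaves it. *)
Lemma scc_connect A B x y z :
    y \in scc A x -> z \in scc A x -> [disjoint scc A x & B] ->
  connect (off B) y z.
Proof.
move=> yx zx dB; move: (zx); rewrite (scc_eq yx) inE => /andP[yz zy].
case/connect_offP: yz => p [yp lp _ pA]; rewrite -lp.
apply: off_path => // w wp.
suff wx: w \in scc A x by move: (disjointFr dB wx) => ->.
rewrite (scc_eq yx) inE; case/splitPr: p / wp yp lp pA => p1 p2.
rewrite cat_path last_cat /= => /and3P[yp1 p1w wp2] lp pA.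
apply/andP; split.
  have := @off_path A y (rcons p1 w); rewrite rcons_path last_rcons yp1 p1w.
  by apply=> // u up; apply: pA; rewrite -cat_rcons mem_cat up.
apply: connect_trans zy; rewrite -lp; apply: off_path => // u up.
by apply: pA; rewrite mem_cat inE up !orbT.
Qed.

End Reach.

Arguments off {T} arc A x y /.

(** * Growing a path into large components *)

Section Haven.
Variables (T : finType) (arc : rel T) (L : nat).
Local Notation rarc := [rel x y | arc y x].

(** The path [y :: p] is listed backwards, from its current end [y] to its
origin. A route from [y] that first comes back to it at [w] closes a cycle that
contains everything listed from [y] to [w]. *)
Lemma back_path_cycle p (y u w : T) :
    path rarc y p -> uniq (y :: p) -> w \in y :: p ->
    connect (off arc [set z in y :: p]) y u -> arc u w ->
  exists2 s, ucycle arc s & index w (y :: p) < size s.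
Proof.
move=> yp up wp /connect_offP[r [yr lr ur rN]] uw.
case/splitPl: wp yp up rN => p1 p2 lw; rewrite cat_path => /andP[yp1 _] up rN.
exists (w :: rev (belast y p1) ++ r).
  apply/andP; split.
    rewrite /= rcons_cat cat_path; apply/andP; split.
      by rewrite -lw rev_path.
    suff -> : last w (rev (belast y p1)) = y by rewrite rcons_path yr lr.
    case: (p1) lw => [|z p1'] //= _.
    by rewrite rev_cons last_rcons.
  have e : perm_eq (w :: rev (belast y p1)) (y :: p1).
    by rewrite [y :: p1]lastI lw perm_sym perm_rcons perm_cons
                perm_sym perm_rev.
  rewrite -cat_cons cat_uniq (perm_uniq e).
  move: up; rewrite -cat_cons cat_uniq => /andP[-> _] /=.
  have -> : uniq r by case/andP: ur.
  rewrite andbT; apply/hasPn => z zr.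
  rewrite /= (perm_mem e); apply: contra (rN z zr) => zp.
  by rewrite inE -cat_cons mem_cat zp.
rewrite -cat_cons size_cat [size (w :: _)]/= size_rev size_belast.
apply: leq_trans (leq_addr _ _); rewrite ltnS -cat_cons index_cat -lw mem_last.
by have := mem_last y p1; rewrite -index_mem.
Qed.

Hypotheses (L_gt0 : 0 < L) (cycleL : forall s, ucycle arc s -> size s <= L).
Hypothesis conn : forall x y, connect arc x y.
Hypothesis big_scc : forall x p,
  path rarc x p -> uniq (x :: p) -> size p <= L ->
  exists2 g, g \notin x :: p & #|T| < #|scc arc [set z in x :: p] g|.*2.

(** As paths are listed backwards, [take L p] consists of the last [L] vertices
of the path, and [ohead p] is its end. *)
Definition growing (p : seq T) (g : T) :=
  [/\ #|T| < #|scc arc [set z in take L p] g|.*2,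
      [disjoint scc arc [set z in take L p] g & p]
    & forall x, ohead p = Some x -> connect (off arc [set z in p]) x g].

Lemma big_meet (A B : {set T}) :
  #|T| < #|A|.*2 -> #|T| < #|B|.*2 -> exists2 x, x \in A & x \in B.
Proof.
move=> bA bB; have [/eqP AB0|[x]] := set_0Vmem (A :&: B); last first.
  by rewrite inE => /andP[]; exists x.
move: (cardsUI A B); rewrite (eqP AB0) cards0.
by have : #|A :|: B| <= #|T| := max_card _; lia.
Qed.

Lemma growing1 x : exists g, growing [:: x] g.
Proof.
have [g gx bg] := @big_scc x [::] isT isT isT; exists g.
rewrite /growing; have -> : take L [:: x] = [:: x] by case: (L) L_gt0.
split=> //.
  rewrite disjoint_sym disjoint_has /= orbF; apply/negP => /scc_notin.
  by rewrite !inE eqxx -mem_seq1 => /(_ gx).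
move=> y [<-]; have := connect_off_self (connect_off0 (conn x g)).
by apply: connect_off_sub; rewrite setU0; apply/subsetP=> z; rewrite !inE.
Qed.

(** The end [x] moves one vertex [y] along its route to the component of [g].
Deleting [y] shrinks the component, and putting back the oldest of the deleted
vertices does not bring it into contact with the path: a route from the
component to the path avoiding the last [L] vertices would close a cycle on
more than [L] vertices. *)
Lemma growing_step x p g : path rarc x p -> uniq (x :: p) ->
    growing (x :: p) g ->
  exists y h, [/\ arc x y, y \notin x :: p & growing [:: y, x & p] h].
Proof.
move=> xp up [bg dg /(_ x erefl) xg].
have gp : g \notin x :: p.
  by rewrite (disjointFr dg (sccxx _ _ _)).
case/connect_offP: xg => -[|y r] [].
  by move=> _ /= eg; move: gp; rewrite -eg mem_head.
rewrite [path _ _ _]/= [last _ _]/= => /andP[xy yr] lr _ rN.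
have yp : y \notin x :: p by have := rN y (mem_head _ _); rewrite inE.
set P := x :: p in bg dg up gp rN yp *.
(* [L + 1] vertices are deleted: [y] and the previous [L]. *)
pose S' := y :: take L P.
have upY : uniq (y :: P) by rewrite cons_uniq yp up.
have [//|//||g' g'S bg'] := @big_scc y (take L P).
- rewrite /P; case: (L) L_gt0 => //= l _; rewrite xy /=.
  by have := take_path l xp.
- by have := take_uniq L.+1 upY.
- by rewrite size_take_min geq_minl.
have g'N : g' \notin [set z in S'] by rewrite inE.
have [h hC hC'] := big_meet bg bg'.
set C := scc _ _ g in bg dg hC; set C' := scc _ _ g' in bg' hC'.
have C'C : C' \subset C.
  have : scc arc [set z in S'] h \subset scc arc [set z in take L P] h.
    apply: scc_sub (sccxx _ _ _); apply/subsetP => z; rewrite !inE => ->.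
    by rewrite orbT.
  by rewrite -(scc_eq hC) -(scc_eq hC').
have dC' : [disjoint C' & y :: P].
  rewrite disjoint_sym disjoint_cons; apply/andP; split.
    by apply/negP => /(scc_notin g'N); rewrite !inE eqxx.
  by rewrite disjoint_sym; apply: disjointWl dg.
have yh : connect (off arc [set z in y :: P]) y h.
  have : connect (off arc [set z in P]) y h.
    apply: (@connect_trans _ _ g).
      rewrite -lr; apply: off_path => // z zr.
      by apply: rN; rewrite inE zr orbT.
    apply: scc_connect (sccxx _ _ _) hC _.
    by rewrite disjoint_sym; rewrite disjoint_sym in dg; move: dg;
       congr is_true; apply: eq_disjoint => z; rewrite inE.
  move=> /connect_off_self; apply: connect_off_sub.
  by apply/subsetP=> z; rewrite !inE.
have hY : h \notin y :: P by rewrite (disjointFr dC' hC').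
exists y, h; split=> //; rewrite -/P.
(* Dropping from [S'] its oldest vertex leaves the last [L] of [y :: P]. *)
have sS : [set z in take L (y :: P)] \subset [set z in S'].
  apply/subsetP => z; rewrite !inE; case: (L) L_gt0 => //= l _.
  rewrite !inE => /orP[->//|zl]; apply/orP; right.
  by change (z \in take l.+1 P); apply: (@mem_take l); rewrite take_takel.
split=> //.
- apply: leq_trans bg' _; rewrite leq_double; apply: subset_leq_card.
  exact: scc_sub.
- rewrite disjoint_sym; apply/pred0P => z /=; apply/negP => /andP[zY].
  rewrite inE => /andP[hz _].
  have [||u [w [hu uw wY wS]]] := connect_off_hit (B := [set z in y :: P]) hz.
  + by rewrite inE.
  + by rewrite inE.
  have yu : connect (off arc [set z in y :: P]) y u.
    by apply: connect_trans yh _; apply: connect_off_sub hu; apply: subsetUr.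
  move: wY; rewrite inE => wY.
  have [|s cs] := back_path_cycle _ upY wY yu uw; first by rewrite /= xy.
  rewrite ltnNge => /negP; apply; apply: leq_trans (cycleL cs) _.
  rewrite leqNgt; apply: contra wS => iL; rewrite inE.
  by rewrite -(nth_index x wY) -(nth_take x iL) mem_nth //
     size_take_min leq_min iL index_mem.
- by move=> _ [<-].
Qed.

(** Each growth step adds a vertex, so the path would exceed [#|T|]. *)
Lemma haven_absurd (x0 : T) : False.
Proof.
suff G n : exists x p g, [/\ path rarc x p, uniq (x :: p), size p = n
                           & growing (x :: p) g].
  have [x [p [g [_ /card_uniqP up sp _]]]] := G #|T|.
  by have := max_card (mem (x :: p)); rewrite up /= sp ltnn.
elim: n => [|n [x [p [g [xp up sp Gg]]]]].
  by have [g Gg] := growing1 x0; exists x0, [::], g.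
have [y [h [xy yN Gh]]] := growing_step xp up Gg.
by exists y, (x :: p), h; split; rewrite ?cons_uniq ?yN //= ?xy ?sp.
Qed.

End Haven.

(** * Isoperimetry by averaging over automorphisms *)

Section Transitive.
Variables (T : finType) (arc : rel T).
Hypotheses (arc_conn : digraph_connected arc) (arc_vt : vertex_transitive arc).
Implicit Types (A B S X : {set T}) (g h : {perm T}).
Local Notation U := (underlying arc).
Local Notation n := #|T|.

Definition auts : {pred {perm T}} :=
  fun g => [forall x, forall y, arc (g x) (g y) == arc x y].

Lemma autsP g : reflect (digraph_aut arc g) (g \in auts).
Proof.
rewrite unfold_in; apply: (iffP forallP) => [H x y | H x].
  by have /forallP/(_ y)/eqP := H x.
by apply/forallP => y; rewrite H.
Qed.

Lemma auts_move u v : exists2 g, g \in auts & g u = v.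
Proof. by have [g /autsP] := arc_vt u v; exists g. Qed.

Lemma autsM g h : g \in auts -> h \in auts -> (g * h)%g \in auts.
Proof. by move=> /autsP Hg /autsP Hh; apply/autsP=> x y; rewrite !permM Hh Hg. Qed.

Lemma autsV g : g \in auts -> (g^-1)%g \in auts.
Proof. by move=> /autsP Hg; apply/autsP=> x y; rewrite -Hg !permKV. Qed.

Lemma underlying_sym : symmetric U.
Proof. by move=> x y; rewrite /underlying /= orbC. Qed.

Lemma underlying_aut g x y : g \in auts -> U (g x) (g y) = U x y.
Proof. by move=> /autsP Hg; rewrite /underlying /= !Hg. Qed.

Definition hits u A := #|[set g in auts | g u \in A]|.

(** Under a uniformly random automorphism [g], the vertex [g u] is uniformly
distributed, by transitivity. *)
Lemma hits_card u A : hits u A * n = #|auts| * #|A|.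
Proof.
pose c w := #|[set g in auts | g u == w]|.
have c_le w w' : c w <= c w'.
  have [h hA hw] := auts_move w w'.
  rewrite /c -(card_imset [set g in auts | g u == w] (mulIg h)).
  apply: subset_leq_card.
  apply/subsetP=> _ /imsetP[g + ->]; rewrite !in_set => /andP[gA /eqP gu].
  by rewrite permM gu hw eqxx autsM.
have hc B : hits u B = #|B| * c u.
  rewrite /hits -sum1_card.
  rewrite (eq_bigl (fun g => (g \in auts) && (g u \in B))); last first.
    by move=> g; rewrite inE.
  rewrite (partition_big (fun g : {perm T} => g u) (mem B)) => [|g /andP[]//].
  rewrite -sum_nat_const; apply: eq_bigr => w wB.
  rewrite sum1dep_card; transitivity (c w); last first.
    by apply/eqP; rewrite eqn_leq !c_le.
  apply: eq_card => g; rewrite !inE; case: eqP => [->|]; last by rewrite !andbF.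
  by rewrite (wB : w \in B) !andbT.
suff -> : #|auts| = n * c u by rewrite (hc A) mulnC mulnA mulnAC.
by rewrite -cardsT -hc; apply: eq_card => g; rewrite !inE andbT.
Qed.

Lemma hits_eq u v A : hits u A = hits v A.
Proof.
have n0 : 0 < n by apply/card_gt0P; exists u.
by apply/eqP; rewrite -(eqn_pmul2r n0) !hits_card.
Qed.

Definition crosses X u v := #|[set g in auts | (g u \in X) && (g v \notin X)]|.

Lemma crosses_trans X u v w : crosses X u w <= crosses X u v + crosses X v w.
Proof.
apply: leq_trans (leq_card_setU _ _); apply: subset_leq_card.
apply/subsetP => g; rewrite in_setU 3!in_set => /and3P[-> -> ->] /=.
by rewrite andbT orNb.
Qed.

(** [g u] and [g v] are equally often in [X]; subtract the [g] for which both
are. *)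
Lemma crosses_sym X u v : crosses X u v = crosses X v u.
Proof.
have H a b : crosses X a b +
    #|[set g in auts | (g a \in X) && (g b \in X)]| = hits a X.
  rewrite /hits -(cardsID [set g : {perm T} | g b \in X]
                          [set g in auts | g a \in X]) addnC.
  by congr (_ + _); apply: eq_card => g; rewrite !inE;
    case: (g a \in X); case: (g b \in X); rewrite ?andbF ?andbT.
have := H u v; have := H v u; rewrite (hits_eq u v) => <-.
suff -> : [set g in auts | (g u \in X) && (g v \in X)] =
          [set g in auts | (g v \in X) && (g u \in X)].
  by move/addIn.
by apply/setP=> g; rewrite !inE [(g u \in X) && _]andbC.
Qed.

Definition outclosed S X := forall x y, x \in X -> arc x y -> y \in X :|: S.

Lemma crosses_arc S X u v :
  outclosed S X -> arc u v -> crosses X u v <= hits v S.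
Proof.
move=> clX uv; apply: subset_leq_card; apply/subsetP => g; rewrite !in_set.
case/and3P=> gA guX gvX; rewrite gA /=; have /autsP Hg := gA.
by have := clX _ _ guX; rewrite -[arc u v]Hg in uv => /(_ _ uv);
   rewrite inE (negbTE gvX).
Qed.

(** Since [crosses] is symmetric, arcs traversed backwards are no worse than
those traversed forwards; this is why distances in the underlying graph are
enough. *)
Lemma crosses_path S X o u p : outclosed S X -> path U u p ->
  crosses X u (last u p) <= size p * hits o S.
Proof.
move=> clX; elim: p u => [|v p IH] u /=.
  move=> _; rewrite leqn0 cards_eq0; apply/eqP/setP => g.
  by rewrite !inE andbN andbF.
case/andP=> uv vp; apply: leq_trans (crosses_trans _ _ v _) _.
rewrite mulSn leq_add ?IH //; case/orP: uv => uv.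
  by rewrite (hits_eq o v); apply: crosses_arc.
by rewrite crosses_sym (hits_eq o u); apply: crosses_arc.
Qed.

(** Count the pairs [(g, t)] with [g o] in [X] and [g t] outside: for fixed [g]
the vertex [g t] runs over all of [T], and for fixed [t] the path from [o] to
[t] has to cross the boundary of [X]. *)
Lemma isoperimetry S X o k : outclosed S X ->
    (forall t, exists p, [/\ path U o p, last o p = t & size p <= k]) ->
  #|X| * #|~: X| <= n * k * #|S|.
Proof.
move=> clX dk.
have n0 : 0 < n by apply/card_gt0P; exists o.
have a0 : 0 < #|auts|.
  by have [g gA _] := auts_move o o; apply/card_gt0P; exists g.
have sumE : \sum_t crosses X o t = hits o X * #|~: X|.
  have -> : \sum_t crosses X o t =
            \sum_(t : T) \sum_(g in auts) (g o \in X) * (g t \notin X).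
    apply: eq_bigr => t _; rewrite /crosses -sum1dep_card big_mkcondr /=.
    by apply: eq_bigr => g _; case: (g o \in X); case: (g t \in X).
  rewrite exchange_big /= /hits -sum1dep_card big_distrl /= [RHS]big_mkcondr /=.
  apply: eq_bigr => g _; rewrite -big_distrr /=.
  have -> : \sum_(t : T) (g t \notin X : nat) = #|~: X|.
    rewrite (reindex_inj (@perm_inj _ g^-1)%g) /= -sum1_card [RHS]big_mkcond /=.
    by apply: eq_bigr => t _; rewrite permKV inE; case: (t \in X).
  by case: (g o \in X); rewrite ?mul1n ?mul0n.
have le : hits o X * #|~: X| <= n * (k * hits o S).
  rewrite -sumE -sum_nat_const; apply: leq_sum => t _.
  have [p [op <- pk]] := dk t; apply: leq_trans (crosses_path o clX op) _.
  by rewrite leq_mul2r pk orbT.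
rewrite -(leq_pmul2l a0) mulnA -(hits_card o).
have -> : #|auts| * (n * k * #|S|) = n * (k * hits o S) * n.
  by rewrite mulnCA -(hits_card o) !mulnA.
by rewrite mulnAC leq_mul2r le orbT.
Qed.

(** The set of vertices reachable from [x] has no arc leaving it, hence, by the
crossing count with [S] empty, no arc entering it either. *)
Lemma strong x y : connect arc x y.
Proof.
pose X := [set z | connect arc x z].
have clX : outclosed set0 X.
  move=> u v; rewrite !inE orbF => xu /connect1; exact: connect_trans.
have h0 : hits x set0 = 0.
  by apply/eqP; rewrite cards_eq0; apply/eqP/setP => g; rewrite !inE andbF.
have /connectP[p xp ->] := arc_conn x y.
have := crosses_path x clX xp; rewrite h0 muln0 leqn0 cards_eq0.
move=> /eqP/setP/(_ 1%g).
rewrite in_set0 in_set !perm1 in_set connect0 /=.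
have -> /= : (1%g : {perm T}) \in auts by apply/autsP=> u v; rewrite !perm1.
by move/negbFE; rewrite inE.
Qed.

(** * Balls and ends of the underlying graph *)

Definition ball k v :=
  [set w | [exists p : k.-bseq T, path U v p && (last v p == w)]].

Lemma ballP k v w :
  reflect (exists p, [/\ path U v p, last v p = w & size p <= k])
          (w \in ball k v).
Proof.
rewrite inE; apply: (iffP existsP) => [[p /andP[vp /eqP lp]]|[p [vp lp pk]]].
  by exists p; split=> //; apply: size_bseq.
by exists (Bseq pk); rewrite /= vp lp /=.
Qed.

Lemma ballxx k v : v \in ball k v.
Proof. by apply/ballP; exists [::]. Qed.

Lemma ball_trans j k u v w :
  v \in ball j u -> w \in ball k v -> w \in ball (j + k) u.
Proof.
move=> /ballP[p [up lp pj]] /ballP[q [vq lq qk]]; apply/ballP; exists (p ++ q).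
by rewrite cat_path last_cat size_cat lp up vq leq_add.
Qed.

Lemma ball_sym k v w : (w \in ball k v) = (v \in ball k w).
Proof.
suff H a b : b \in ball k a -> a \in ball k b by apply/idP/idP; apply: H.
move=> /ballP[p [ap <- pk]]; apply/ballP; exists (rev (belast a p)).
rewrite size_rev size_belast; split=> //.
  by rewrite rev_path (eq_path (e' := U)) // => x y; rewrite underlying_sym.
by case: (p) => //= z q; rewrite rev_cons last_rcons.
Qed.

Lemma ball_aut k g v w : g \in auts -> w \in ball k v -> g w \in ball k (g v).
Proof.
move=> gA /ballP[p [vp <- pk]]; apply/ballP; exists (map g p).
rewrite size_map last_map; split=> //.
by rewrite path_map (eq_path (e' := U)) // => x y; apply: underlying_aut.
Qed.

Lemma ball_autE k g v w : g \in auts -> (g w \in ball k (g v)) = (w \in ball k v).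
Proof.
move=> gA; apply/idP/idP; last exact: ball_aut.
by move/(ball_aut (autsV gA)); rewrite !permK.
Qed.

Lemma card_ball k v w : #|ball k v| = #|ball k w|.
Proof.
suff H a b : #|ball k a| <= #|ball k b| by apply/eqP; rewrite eqn_leq !H.
have [g gA <-] := auts_move a b; rewrite -(card_imset _ (@perm_inj _ g)).
by apply: subset_leq_card; apply/subsetP=> _ /imsetP[x xa ->]; apply: ball_aut.
Qed.

Lemma balls_disjoint k v w :
  w \notin ball (k + k) v -> [disjoint ball k v & ball k w].
Proof.
move=> wv; apply/pred0P => z /=; apply: contraNF wv => /andP[zv].
by rewrite ball_sym; apply: ball_trans.
Qed.

(** The balls about [v] and [w] are disjoint translates of one another. The
radius in the hypothesis has one unit to spare: the first vertex outside the
ball of [v] on a path to [w] is in neither ball, which makes the inequality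
strict. *)
Lemma ball_lt_half r v w : w \notin ball (r + r).+1 v -> #|ball r v|.*2 < n.
Proof.
move=> wv.
have dis : [disjoint ball r v & ball r w].
  apply: balls_disjoint; apply: contra wv => /ballP[p [vp lp pk]].
  by apply/ballP; exists p; split=> //; apply: leqW.
have [u uv uw] : exists2 u, u \notin ball r v & u \notin ball r w.
  have wB : w \notin ball r v.
    by apply/negP => /(disjointFr dis); rewrite ballxx.
  have := connect_off0 (arc := U) (arc_conn v w).
  case/(connect_off_hit (B := ~: ball r v)); rewrite ?in_setC ?ballxx //.
  move=> x [y [vx xy yv _]]; exists y; first by rewrite -in_setC.
  have xv : x \in ball r v.
    have := connect_off_notin vx.
    by rewrite !in_setU !in_set0 !in_setC ballxx /= negbK; apply.
  apply: contra wv => yw; rewrite -addSn -addn1; apply: (@ball_trans _ _ _ y).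
    apply: ball_trans xv _; apply/ballP; exists [:: y]; split=> //=.
    by rewrite xy.
  by rewrite ball_sym.
have := cardsUI (ball r v) (ball r w).
move: dis; rewrite -setI_eq0 => /eqP->.
rewrite cards0 (card_ball _ w v) addn0 addnn => <-.
rewrite -cardsT; apply: proper_card; apply/properP; split; first exact: subsetT.
by exists u; rewrite ?in_setT // in_setU negb_or uv.
Qed.

(** Unlike [off], this relation also forbids the start of a path to lie in
[B], which makes it symmetric. *)
Definition link B : rel T := fun x y => [&& U x y, x \notin B & y \notin B].

Lemma link_sym B : symmetric (link B).
Proof.
by move=> x y; rewrite /link underlying_sym; congr (_ && _); rewrite andbC.
Qed.

Lemma connect_link_sym B : connect_sym (link B).
Proof. exact/sym_connect_sym/link_sym. Qed.

Lemma connect_link_aut r g v x y : g \in auts ->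
  connect (link (ball r v)) x y -> connect (link (ball r (g v))) (g x) (g y).
Proof.
move=> gA /connectP[p + ->]; elim: p x => //= z p IH x /andP[xz zp].
apply: connect_trans (IH z zp); apply: connect1; move: xz.
by rewrite /link underlying_aut // !ball_autE.
Qed.

Lemma connect_link_notin B x y :
  connect (link B) x y -> x \notin B -> y \notin B.
Proof.
case/connectP=> p + ->; elim: p x => //= z p IH x /andP[/and3P[_ _ zB] zp] _.
exact: IH.
Qed.

Lemma ball_link r v w B :
  [disjoint ball r v & B] -> w \in ball r v -> connect (link B) v w.
Proof.
move=> dis /ballP[p [vp <- pr]]; elim/last_ind: p vp pr => // p x IH.
rewrite rcons_path last_rcons size_rcons => /andP[vp px] pr.
apply: connect_trans (IH vp (ltnW pr)) _; apply: connect1.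
rewrite /link px /= !(disjointFr dis) //; apply/ballP.
  by exists (rcons p x); rewrite rcons_path last_rcons size_rcons vp px.
by exists p; rewrite vp (ltnW pr).
Qed.

(** Suppose that the ball about [v] separates the far vertices [a] and [b], and
take the component [K] of [a] as small as possible. Translate the picture by an
automorphism that maps [v] to [a]. The new ball lies inside [K], so that
everything outside [K] stays connected; of the two separated images of [a] and
[b], one is therefore cut off from the outside of [K]. Its component is inside
[K] and misses [a], so it is smaller than [K]. *)
Lemma one_end r v a b : a \notin ball (r + r) v -> b \notin ball (r + r) v ->
  connect (link (ball r v)) a b.
Proof.
have [m] := ubnP #|[set z | connect (link (ball r v)) a z]|.
elim: m v a b => // m IH v a b; set K := [set z | _]; rewrite ltnS => Km av bv.
apply/negPn/negP => ab.
have dis := balls_disjoint av.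
have aB : a \notin ball r v by apply/negP => /(disjointFr dis); rewrite ballxx.
have subK : ball r a \subset K.
  apply/subsetP => w wa; rewrite inE; apply: ball_link wa.
  by rewrite disjoint_sym.
(* The complement of [K] is connected and avoids the ball about [a]. *)
have coK z : z \notin K -> connect (link (ball r a)) z v.
  have /connectP[p] := arc_conn z v.
  elim: p z => [|z1 p IHp] z /=; first by move=> _ <-.
  case/andP=> zz1 z1p lp zK.
  have [zB|zB] := boolP (z \in ball r v).
    by rewrite connect_link_sym; apply: ball_link zB.
  have z1K : z1 \notin K.
    apply: contra zK; rewrite !inE => az1; apply: (connect_trans az1).
    apply: connect1; rewrite /link underlying_sym zz1 zB andbT.
    exact: connect_link_notin az1 aB.
  apply: connect_trans (IHp z1 z1p lp z1K); apply: connect1.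
  rewrite /link zz1 /=; apply/andP; split.
    by apply: contra zK; apply: (subsetP subK).
  by apply: contra z1K; apply: (subsetP subK).
have [g gA gv] := auts_move v a.
have far c : c \notin ball (r + r) v -> g c \notin ball (r + r) a.
  by rewrite -gv ball_autE.
have gab : ~~ connect (link (ball r a)) (g a) (g b).
  apply: contra ab; rewrite -gv => /(connect_link_aut (autsV gA)).
  by rewrite !permK.
(* By minimality of [K], neither image is cut off from the outside of [K]. *)
have shrink c d : c \notin ball (r + r) a -> d \notin ball (r + r) a ->
    ~~ connect (link (ball r a)) c d -> connect (link (ball r a)) c v.
  move=> ca da; apply: contraR => cv; apply: IH => //.
  apply: leq_trans Km; apply: proper_card; apply/properP; split.
    apply/subsetP => z; rewrite inE => cz; apply: contraR cv => /coK.
    exact: connect_trans.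
  exists a; first by rewrite inE connect0.
  have cB : c \notin ball r a.
    apply: contra ca => /ballP[p [ap lp pr]]; apply/ballP; exists p.
    by rewrite (leq_trans pr (leq_addr _ _)).
  rewrite inE; apply/negP => /connect_link_notin/(_ cB).
  by rewrite ballxx.
case/negP: (gab); apply: (@connect_trans _ _ v).
  by apply: shrink gab; apply: far.
rewrite connect_link_sym; apply: (shrink _ (g a)); try exact: far.
by rewrite connect_link_sym.
Qed.

End Transitive.

(** * Large strong components *)

Section BigComponent.
Variables (T : finType) (arc : rel T).
Implicit Types (S X : {set T}).

Lemma outclosed_connect S X x y :
  outclosed arc S X -> x \in X -> connect (off arc S) x y -> y \in X.
Proof.
move=> clX + /connectP[p + ->].
elim: p x => //= z p IH x xX /andP[/andP[xz zS] zp].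
by apply: IH zp; have := clX _ _ xX xz; rewrite inE (negbTE zS) orbF.
Qed.

(** Let [X] be out-closed and not small, and let [x] in [X] reach as many
vertices as possible. The set [K] of vertices of [X] that reach [x] is strongly
connected, since they reach nothing that [x] does not, and what remains of [X]
is out-closed. Either the rest is small, and then [K] is the complement of two
small sets, or the argument is repeated with the rest in place of [X]. *)
Lemma big_scc_of_small S (small : pred {set T}) :
    (forall A B, small A -> small B -> #|A :|: B|.*2 < #|T|) ->
    (forall X, outclosed arc S X -> [disjoint X & S] ->
      small X || small (~: X)) ->
    small S ->
  exists2 x, x \notin S & #|T| < #|scc arc S x|.*2.
Proof.
move=> smallU dich sS.
have notT A : small A -> small (~: A) -> False.
  by move=> sA sA'; have := smallU _ _ sA sA'; rewrite setUCr cardsT; lia.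
(* Start from the complement of [S]. *)
suff G m X : #|X| < m -> outclosed arc S X -> [disjoint X & S] -> ~~ small X ->
    exists2 x, x \notin S & #|T| < #|scc arc S x|.*2.
  apply: (G _ (~: S)) (leqnn _) _ _ _.
  - by move=> x y _ _; rewrite inE inE orNb.
  - by rewrite disjoint_sym -subsets_disjoint.
  - by apply/negP; apply: notT.
elim: m X => // m IH X Xm clX dX nsX.
have sX' : small (~: X) by have := dich X clX dX; rewrite (negbTE nsX).
have [X0|[x0 x0X]] := set_0Vmem X.
  by have := smallU _ _ sX' sX'; rewrite setUid X0 setC0 cardsT; lia.
pose reach x := [set z | connect (off arc S) x z].
case: (@arg_maxnP _ x0 (mem X) (fun x => #|reach x|) x0X) => x xX xmax.
have {}xX : x \in X by [].
have xS : x \notin S by rewrite (disjointFr dX).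
pose K := [set y in X | connect (off arc S) y x].
have Kscc : K \subset scc arc S x.
  apply/subsetP => y; rewrite !inE => /andP[yX yx]; rewrite yx andbT.
  have sub : reach x \subset reach y.
    by apply/subsetP => z; rewrite !inE; apply: connect_trans.
  have /setP/(_ y) : reach x = reach y.
    by apply/eqP; rewrite eqEcard sub; apply: xmax.
  by rewrite !inE connect0.
have xK : x \in K by rewrite inE xX connect0.
have clXK : outclosed arc S (X :\: K).
  move=> y z; rewrite !inE => /andP[yK yX] yz.
  have := clX _ _ yX yz; rewrite inE.
  have [//|zS] := boolP (z \in S); first by rewrite !orbT.
  rewrite !orbF => zX; rewrite zX andbT /=.
  move: yK; rewrite yX /=; apply: contra => zx; apply: connect_trans zx.
  by apply: connect1; rewrite /= yz zS.
have dXK : [disjoint X :\: K & S] by apply: disjointWl dX; apply: subsetDl.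
have [sXK|] := boolP (small (X :\: K)); last first.
  apply: IH => //; rewrite ltnS in Xm; apply: leq_trans Xm; apply: proper_card.
  by apply/properP; split; [apply: subsetDl|exists x; rewrite // inE xK].
exists x => //; have := smallU _ _ sX' sXK; have := subset_leq_card Kscc.
have : #|K| + #|~: K| = #|T| by rewrite cardsC.
have -> : ~: X :|: X :\: K = ~: K.
  by apply/setP => z; rewrite !inE;
     case: (z \in X); rewrite /= ?andbT ?andbF ?orbF.
lia.
Qed.

End BigComponent.

Section Main.
Variables (T : finType) (arc : rel T) (L : nat).
Hypotheses (arc_conn : digraph_connected arc) (arc_vt : vertex_transitive arc).
Hypotheses (L_gt0 : 0 < L) (cycleL : forall s, ucycle arc s -> size s <= L).
Local Notation U := (underlying arc).
Local Notation ball := (ball arc).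
Implicit Types (S X : {set T}).

Lemma path_ball (e : rel T) k x p z : subrel e U -> path e x p ->
  size p <= k -> z \in x :: p -> z \in ball k x.
Proof.
move=> eU xp pk zp; case/splitPl: zp xp pk => p1 p2 lz.
rewrite cat_path size_cat => /andP[xp1 _] pk; apply/ballP; exists p1; split=> //.
  exact: sub_path xp1.
exact: leq_trans (leq_addr _ _) pk.
Qed.

(** If both sides had a vertex outside the large ball, an underlying path
between them outside the small ball would contain an edge [x y] across the
boundary of [X]. The arc between [x] and [y] must enter [X], and the cycle
through it meets [S] within distance [L] of [x], so that [x] is in the small
ball after all. *)
Lemma outclosed_in_ball v S X : S \subset ball L v -> outclosed arc S X ->
  (X \subset ball (L + L + (L + L)) v)
  || (~: X \subset ball (L + L + (L + L)) v).
Proof.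
move=> Sv clX; apply/negPn/negP; rewrite negb_or => /andP[/subsetPn[a aX av]].
move=> /subsetPn[b bX bv].
have := connect_off0 (one_end arc_conn arc_vt av bv).
case/(connect_off_hit (B := ~: X)); rewrite ?in_setC ?aX //.
  by rewrite -in_setC.
move=> x [y [ax /and3P[xy xv yv] yX _]].
have {ax} xX : x \in X.
  have := connect_off_notin ax.
  by rewrite !in_setU !in_set0 !in_setC aX /= negbK; apply.
rewrite in_setC in yX.
have yS : y \notin S.
  apply: contra yv => /(subsetP Sv)/ballP[p [vp lp pL]].
  by apply/ballP; exists p; rewrite (leq_trans pL (leq_addr _ _)).
case/orP: xy => [xy|yx].
  by have := clX _ _ xX xy; rewrite inE (negbTE yX) (negbTE yS).
have /connect_off0/connect_offP[p [xp lp up _]] := strong arc_conn arc_vt x y.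
have pL : size p < L.
  apply: (@cycleL (x :: p)).
  by rewrite /ucycle up andbT /= rcons_path xp lp.
have [/hasP[s sp sS]|pS] := boolP (has (mem S) p).
  case/negP: xv; apply: (@ball_trans _ _ _ _ _ s); first exact: (subsetP Sv).
  rewrite ball_sym; apply: (path_ball _ xp (ltnW pL)); last first.
    by rewrite inE sp orbT.
  by move=> u w uw; apply/orP; left.
case/negP: yX; apply: (outclosed_connect clX xX); rewrite -lp.
by apply: off_path xp _ => z zp; apply: (hasPn pS).
Qed.

(** Every small set has at most [36 L^2] vertices when the diameter is at most
[8 L + 1]; two of them then cover less than half of the vertices. *)
Lemma big_scc_near v S : 144 * L ^ 2 < #|T| ->
    S \subset ball L v -> #|S| <= L.+1 ->
  exists2 x, x \notin S & #|T| < #|scc arc S x|.*2.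
Proof.
move=> Tbig Sv SL; pose R := L + L + (L + L).
have [/existsP[w wv]|/existsPn near] :=
  boolP [exists w, w \notin ball (R + R).+1 v].
  apply: (big_scc_of_small (small := fun A => A \subset ball R v)).
  - move=> A B Av Bv; apply: leq_ltn_trans (ball_lt_half arc_conn arc_vt wv).
    by rewrite leq_double; apply: subset_leq_card; rewrite subUset Av.
  - by move=> X clX _; apply: (outclosed_in_ball Sv).
  - apply: subset_trans Sv _; apply/subsetP => z /ballP[p [vp lp pL]].
    by apply/ballP; exists p; rewrite (leq_trans pL) // /R -!addnA leq_addr.
pose m := ((R + R).+1 * L.+1).*2.
have mL : m <= 36 * L ^ 2.
  have : L <= L * L by rewrite leq_pmulr.
  by rewrite /m /R -mulnn; nia.
apply: (big_scc_of_small (small := fun A => #|A| <= m)).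
- move=> A B Am Bm; rewrite cardsU.
  apply: leq_ltn_trans Tbig; lia.
- move=> X clX _; rewrite -implyNb; apply/implyP; rewrite -ltnNge => mX.
  rewrite leqNgt; apply/negP => mX'.
  have iso := @isoperimetry T arc arc_vt S X v (R + R).+1 clX _.
  have {}iso : #|X| * #|~: X| <= #|T| * (R + R).+1 * #|S|.
    by apply: iso => t; apply/ballP; have := near t; rewrite negbK.
  apply/negP: iso; rewrite -ltnNge -ltn_double.
  apply: (@leq_ltn_trans (#|T| * m)).
    by rewrite /m -doubleMr leq_double mulnA leq_mul2l SL orbT.
  rewrite -(cardsC X); move: #|X| #|~: X| m mX mX' {mL} => a b c ca cb.
  nia.
- by rewrite /m /R; nia.
Qed.

(** * The longest directed cycle *)

Lemma card_le_cycle : #|T| <= 144 * L ^ 2.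
Proof.
rewrite leqNgt; apply/negP => Tbig.
have [x0 _] : exists x0 : T, x0 \in T.
  by apply/card_gt0P; apply: leq_ltn_trans Tbig.
apply: (haven_absurd L_gt0 cycleL (strong arc_conn arc_vt) _ x0).
move=> x p xp up pL.
have [||g gS bg] := @big_scc_near x [set z in x :: p] Tbig.
- apply/subsetP => z; rewrite inE; apply: path_ball xp pL.
  by move=> u w uw; apply/orP; right.
- by rewrite cardsE; apply: leq_trans (card_size _) _.
by exists g => //; rewrite inE in gS.
Qed.

End Main.

Local Open Scope ring_scope.

Theorem theorem1p5 (R : realType) :
  exists2 c : R, 0 < c &
    forall (T : finType) (arc : rel T),
      irreflexive arc ->
      digraph_connected arc ->
      vertex_transitive arc ->
      (2 <= #|T|)%N ->
      exists2 s : seq T,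
        directed_cycle arc s & c * Num.sqrt (#|T|%:R) <= (size s)%:R.
Proof.
exists 12%:R^-1; first by rewrite invr_gt0.
move=> T arc _ arc_conn arc_vt T2.
pose P (s : #|T|.-bseq T) := ucycleb arc s.
have ucycle_bseq s : ucycle arc s -> exists2 t, P t & s = t.
  move=> cs; have sT : (size s <= #|T|)%N.
    by case/andP: cs => _ /card_uniqP <-; apply: max_card.
  by exists (Bseq sT).
have [s0 cs0 s0_gt0] : exists2 s, ucycle arc s & (0 < size s)%N.
  have /card_gt1P[x [y [_ _ xy]]] := T2.
  have /connectP[[|z p]] := strong arc_conn arc_vt x y.
    by move=> _ eyx; rewrite eyx eqxx in xy.
  move=> /andP[xz _] _; have := strong arc_conn arc_vt z x.
  move/connect_off0/connect_offP => [q [zq lq uq _]].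
  by exists (z :: q) => //; rewrite /ucycle uq /= rcons_path zq lq xz.
have [t0 Pt0 et0] := ucycle_bseq _ cs0.
case: (@arg_maxnP _ t0 P (fun t => size t) Pt0) => t Pt tmax.
have cycleL s : ucycle arc s -> (size s <= size t)%N.
  by case/ucycle_bseq => t1 Pt1 ->; apply: tmax.
have t_gt0 : (0 < size t)%N by apply: leq_trans s0_gt0 (cycleL _ cs0).
exists t; first by split=> //; move=> t_nil; rewrite t_nil in t_gt0.
(* The constant is [1 / 12] because [144 L^2] is the square of [12 L]. *)
rewrite ler_pdivrMl // -[leRHS]ger0_norm ?mulr_ge0 // -sqrtr_sqr.
rewrite ler_sqrt ?sqr_ge0 //.
rewrite -natrM -natrX ler_nat.
apply: leq_trans (card_le_cycle arc_conn arc_vt t_gt0 cycleL) _.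
by rewrite expnMn.
Qed.
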